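(* Let $f:\mathbb{P}_d\to\mathbb{R}$ be g-convex. Then the function $g:\mathbb{P}_d\to\mathbb{R}$ defined by $g(X)=f(X^{-1})$ is also g-convex.
   Context: $\mathbb{P}_d$ is the set of $d\times d$ real symmetric positive definite matrices, equipped with the affine-invariant Riemannian metric $\langle U,V\rangle_X=\operatorname{tr}(X^{-1}UX^{-1}V)$ for symmetric $U,V$. The unique geodesic from $A$ to $B$ is $A\sharp_t B=A^{1/2}(A^{-1/2}BA^{-1/2})^tA^{1/2}$, $t\in[0,1]$. A function $f:\mathbb{P}_d\to\mathbb{R}$ is geodesically convex (g-convex) if $f(A\sharp_t B)\le(1-t)f(A)+tf(B)$ for all $A,B\in\mathbb{P}_d$ and $t\in[0,1]$. All functions considered are assumed continuous. *)

(* Defs.v *)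
From HB Require Import structures.
From mathcomp Require Import all_boot all_order all_algebra.
From mathcomp Require Import all_classical all_reals all_analysis.
Set Implicit Arguments.
Unset Strict Implicit.
Unset Printing Implicit Defensive.
Import Order.TTheory GRing.Theory Num.Theory.
Import numFieldNormedType.Exports.
Local Open Scope classical_set_scope.
Local Open Scope ring_scope.

Section PositiveDefinite.
Variables (R : realType) (d : nat).
Implicit Types (A B S M : 'M[R]_d) (t : R) (f : 'M[R]_d -> R).

Definition posdefmx : set 'M[R]_d :=
  [set A | A \is symmetricmx /\
           forall x : 'cV[R]_d, x != 0 -> 0 < (x^T *m A *m x) 0 0].

(* M is obtained from S by raising to the power t the eigenvalues l in some
   orthogonal diagonalization S = Q diag(l) Q^T. *)
Definition is_mxpow S t M : Prop :=
  exists (Q : 'M[R]_d) (l : 'rV[R]_d),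
    [/\ Q *m Q^T = 1%:M,
        S = Q *m diag_mx l *m Q^T &
        M = Q *m diag_mx (\row_i (l 0 i `^ t)) *m Q^T].

(* Symmetric matrices S have exactly one M with is_mxpow S t M (it does not
   depend on the diagonalization); the value is S^t when S is positive definite,
   the only case of interest. For other S, mxpow S t is a junk value. *)
Definition mxpow S t : 'M[R]_d := xget 0 [set M | is_mxpow S t M].

(* The geodesic from A to B for the affine-invariant metric
   <U, V>_X = tr(X^-1 U X^-1 V) on the positive definite cone. *)
Definition geodesic A B t : 'M[R]_d :=
  mxpow A 2^-1
    *m mxpow (mxpow A (- 2^-1) *m B *m mxpow A (- 2^-1)) t
    *m mxpow A 2^-1.

(* A function on the positive definite cone is represented by a function on
   all matrices, whose values elsewhere are irrelevant. *)
Definition g_convex f : Prop :=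
  forall A B t, posdefmx A -> posdefmx B -> 0 <= t <= 1 ->
    f (geodesic A B t) <= (1 - t) * f A + t * f B.

End PositiveDefinite.

Arguments posdefmx {R d}.

(* Main.v *)
(* If S = Q diag(l) Q^T is invertible then S^-1 = Q diag(1/l) Q^T, so matrix
   powers satisfy S^(-t) = (S^-1)^t = (S^t)^-1, and substituting this in the
   formula of the geodesic from A^-1 to B^-1 gives the inverse of the geodesic
   from A to B. Continuity of the inverse comes from Cramer's formula.

   The spectral theorem is not needed: if S has no orthogonal diagonalization,
   neither has S^-1, and all their powers have the junk value 0, for which the
   same identities hold because [invmx 0 = 0]. *)
Require Import Defs.
From mathcomp Require Import all_boot all_order all_algebra.
From mathcomp Require Import all_classical all_reals all_analysis.
Set Implicit Arguments.
Unset Strict Implicit.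
Unset Printing Implicit Defensive.
Import Order.TTheory GRing.Theory Num.Theory.
Import numFieldNormedType.Exports.
Local Open Scope classical_set_scope.
Local Open Scope ring_scope.

Lemma invmx0 (R : comUnitRingType) n : invmx 0 = 0 :> 'M[R]_n.
Proof.
have [u0|/invmx_out->//] := boolP ((0 : 'M[R]_n) \in unitmx).
(* This case arises only for n = 0. *)
by rewrite -[LHS]mul1mx -(mulVmx u0) mulmx0 mul0mx.
Qed.

Lemma invmxM (R : comUnitRingType) n (M N : 'M[R]_n) :
  M \in unitmx -> N \in unitmx ->
  invmx (M *m N) = invmx N *m invmx M.
Proof.
move=> Mu Nu; have MNu : M *m N \in unitmx by rewrite unitmx_mul Mu.
by apply: (can_inj (mulKmx MNu)); rewrite mulmxV// mulmxA mulmxK// mulmxV.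
Qed.

Lemma cvg_matrix (T : Type) (F : set_system T) {FF : Filter F}
    (K : topologicalType) m n (f : T -> 'M[K]_(m, n)) (M : 'M[K]_(m, n)) :
  (forall i j, f x i j @[x --> F] --> M i j) -> f x @[x --> F] --> M.
Proof.
move=> fM U [P MP PU].
suff : \forall x \near F, forall i j, P i j (f x i j).
  by apply: filterS => x Px; apply: PU.
by apply: filter_forall => i; apply: filter_forall => j; apply: fM; apply: MP.
Qed.

(** By the Leibniz formula the determinant is a finite sum of finite products of entries. *)
Lemma cvg_det (K : numFieldType) (T : Type) (F : set_system T) {FF : Filter F}
    n (f : T -> 'M[K]_n) (M : 'M[K]_n) :
  (forall i j, f x i j @[x --> F] --> M i j) ->
  \det (f x) @[x --> F] --> \det M.
Proof.
move=> fM; rewrite /determinant.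
apply: (cvg_big (@add_continuous K)) => s _.
apply: cvgM; first exact: cvg_cst.
by apply: (cvg_big (@mul_continuous K)) => i _; apply: fM.
Qed.

Lemma cvg_invmx (K : numFieldType) (T : Type) (F : set_system T)
    {FF : Filter F} n (f : T -> 'M[K]_n) (M : 'M[K]_n) : M \in unitmx ->
  (forall i j, f x i j @[x --> F] --> M i j) ->
  invmx (f x) @[x --> F] --> invmx M.
Proof.
move=> Mu fM; have detM : \det M != 0 by rewrite -unitfE -unitmxE.
have fdet : \det (f x) @[x --> F] --> \det M by exact: cvg_det.
rewrite {2}/invmx Mu.
(* [invmx] is defined by cases on invertibility. The determinant has a nonzero limit, so it is
   eventually nonzero along [F] and Cramer's formula applies there. *)
apply: (@cvg_trans _ ((\det (f x))^-1 *: \adj (f x) @[x --> F])).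
  apply: near_eq_cvg.
  have : \forall x \near F, \det (f x) != 0 by exact: cvgr_neq0 fdet detM.
  by apply: filterS => x; rewrite /invmx unitmxE unitfE => ->.
apply: cvg_matrix => i j.
rewrite !mxE; under eq_cvg do rewrite !mxE.
apply: cvgM; first exact: cvgV.
apply: cvgM; first exact: cvg_cst.
apply: cvg_det => k l.
by rewrite !mxE; under eq_cvg do rewrite !mxE; apply: fM.
Qed.

Lemma invmx_continuous (K : numFieldType) n (A : 'M[K]_n) :
  A \in unitmx -> {for A, continuous (@invmx K n)}.
Proof.
move=> Au; apply: (@cvg_invmx _ _ _ (nbhs_filter A)) Au _ => i j.
exact: (@coord_continuous K n n i j).
Qed.

Lemma posdefmx_unit (R : realType) d (A : 'M[R]_d) : posdefmx A -> A \in unitmx.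
Proof.
(* [kermx] is a left kernel. Passing to [A^T] turns its rows, once transposed, into columns x with A
   x = 0, and a nonzero one would contradict x^T A x > 0. *)
move=> [_ Apos]; rewrite -unitmx_tr -row_free_unit -kermx_eq0.
apply/eqP/row_matrixP => i; rewrite row0; apply/eqP/negP => /negP kn0.
have := Apos (row i (kermx A^T))^T; rewrite -trmx0 (inj_eq trmx_inj).
move=> /(_ kn0); rewrite -mulmxA.
have -> : A *m (row i (kermx A^T))^T = 0.
  by rewrite -[A in A *m _]trmxK -trmx_mul -row_mul mulmx_ker row0 trmx0.
by rewrite mulmx0 mxE ltxx.
Qed.

Lemma posdefmx_inv (R : realType) d (A : 'M[R]_d) :
  posdefmx A -> posdefmx (invmx A).
Proof.
move=> Apos; have Au := posdefmx_unit Apos; case: Apos => Asym Apos.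
have AT : A^T = A.
  move: Asym; rewrite is_hermitianmxE expr0 scale1r => /eqP {2}->.
  by rewrite map_mx_id.
split.
  by rewrite is_hermitianmxE expr0 scale1r map_mx_id// trmx_inv AT.
(* With y = A^-1 x, the form x^T A^-1 x equals y^T A y. *)
move=> x x0; have := Apos (invmx A *m x).
rewrite trmx_mul trmx_inv AT -!mulmxA mulKVmx//; apply.
by apply: contra x0 => /eqP y0; rewrite -(mulKVmx Au x) y0 mulmx0.
Qed.

Section MatrixPower.
Variables (R : realType) (d : nat).
Implicit Types (A B Q S M N : 'M[R]_d) (l k : 'rV[R]_d) (t s : R).

(* M i j is nonzero only if k i = l j. *)
Lemma intertwine_diag (g : R -> R) k l M :
  diag_mx k *m M = M *m diag_mx l ->
  diag_mx (\row_i g (k 0 i)) *m M = M *m diag_mx (\row_i g (l 0 i)).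
Proof.
move=> kMl; apply/matrixP => i j; move/matrixP/(_ i j): kMl.
rewrite !mul_diag_mx !mul_mx_diag !mxE.
have [->|M0] := eqVneq (M i j) 0; first by rewrite !mulr0 !mul0r.
by rewrite mulrC => /(mulfI M0) ->; rewrite mulrC.
Qed.

(** The change of eigenbasis [W] = P^T Q intertwines the two diagonal matrices of eigenvalues, hence
    also their powers. *)
Lemma is_mxpow_uniq S t M N : is_mxpow S t M -> is_mxpow S t N -> M = N.
Proof.
move=> [Q [l [QQ SE ->]]] [P [k [PP SE' ->]]].
have QQ' := mulmx1C QQ; have PP' := mulmx1C PP.
set W := P^T *m Q.
have comm : diag_mx k *m W = W *m diag_mx l.
  rewrite /W; have := congr1 (fun X => P^T *m X *m Q) SE.
  rewrite {1}SE' !mulmxA PP' mul1mx => ->.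
  by rewrite -!mulmxA QQ' mulmx1.
have commt := intertwine_diag (fun x => x `^ t) comm.
have QE : Q = P *m W by rewrite /W mulmxA PP mul1mx.
by rewrite {1}QE -[P *m W *m _]mulmxA -commt /W -!mulmxA QQ mulmx1.
Qed.

Lemma mxpowE S t M : is_mxpow S t M -> mxpow S t = M.
Proof.
move=> SM; apply: (is_mxpow_uniq _ SM).
exact: (@xgetI _ 0 [set N | is_mxpow S t N] M SM).
Qed.

Lemma is_mxpow_exp S s t M : is_mxpow S s M -> exists N, is_mxpow S t N.
Proof.
by move=> [Q [l [QQ SE _]]]; exists (Q *m diag_mx (\row_i (l 0 i `^ t)) *m Q^T);
  exists Q, l.
Qed.

(** An orthogonal diagonalization of [S] serves every exponent, so a single case split settles all
    powers of [S] at once. *)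
Lemma mxpowP S :
  (forall t, is_mxpow S t (mxpow S t)) \/ (forall t, mxpow S t = 0).
Proof.
have [[s [M SM]]|nS] := pselect (exists s M, is_mxpow S s M).
  by left=> t; have [N SN] := is_mxpow_exp t SM; rewrite (mxpowE SN).
by right=> t; apply: xgetPN => M SM; apply: nS; exists t, M.
Qed.

Lemma conj_diag_unit Q l : Q *m Q^T = 1%:M ->
  (Q *m diag_mx l *m Q^T \in unitmx) = [forall i, l 0 i != 0].
Proof.
move=> QQ; have [Qu QTu] := mulmx1_unit QQ.
rewrite !unitmx_mul Qu QTu andbT /= unitmxE det_diag unitfE.
apply/prodf_neq0/forallP => l0 i *; exact: l0.
Qed.

Lemma conj_diag_inv Q l : Q *m Q^T = 1%:M -> (forall i, l 0 i != 0) ->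
  invmx (Q *m diag_mx l *m Q^T) = Q *m diag_mx (\row_i (l 0 i)^-1) *m Q^T.
Proof.
move=> QQ l0; set D := Q *m _ *m _.
have Du : D \in unitmx by rewrite conj_diag_unit//; apply/forallP.
apply: (can_inj (mulKmx Du)); rewrite mulmxV// /D !mulmxA.
rewrite -[_ *m Q^T *m Q]mulmxA (mulmx1C QQ) mulmx1.
rewrite -[_ *m diag_mx _ *m diag_mx _]mulmxA mulmx_diag.
rewrite (_ : diag_mx _ = 1%:M) ?mulmx1//.
by apply/matrixP => i j; rewrite !mxE mulfV.
Qed.

Lemma is_mxpow_unit S t M : S \in unitmx -> is_mxpow S t M -> M \in unitmx.
Proof.
move=> Su [Q [l [QQ SE ->]]]; move: Su; rewrite SE !conj_diag_unit//.
by move=> /forallP l0; apply/forallP => i; rewrite mxE powR_eq0 (negPf (l0 i)).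
Qed.

Lemma is_mxpowN S t M : S \in unitmx ->
  is_mxpow S t M -> is_mxpow S (- t) (invmx M).
Proof.
move=> Su SM; have Mu := is_mxpow_unit Su SM.
case: SM Mu => Q [l [QQ SE ->]]; rewrite conj_diag_unit// => /forallP lt0.
exists Q, l; split=> //; rewrite conj_diag_inv//.
by congr (_ *m diag_mx _ *m _); apply/rowP => i; rewrite !mxE powRN.
Qed.

Lemma is_mxpow_inv S t M : S \in unitmx ->
  is_mxpow S t M -> is_mxpow (invmx S) t (invmx M).
Proof.
move=> Su SM; have Mu := is_mxpow_unit Su SM.
case: SM Su Mu => Q [l [QQ -> ->]]; rewrite !conj_diag_unit//.
move=> /forallP l0 /forallP lt0.
exists Q, (\row_i (l 0 i)^-1); rewrite !conj_diag_inv//; split=> //.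
congr (_ *m diag_mx _ *m _); apply/rowP => i; rewrite !mxE.
rewrite /powR invr_eq0 (negPf (l0 i)).
have [l_gt0|l_le0] := ltP 0 (l 0 i).
  by rewrite lnV ?posrE// mulrN expRN.
(* [ln] vanishes on negative reals, so all their powers are 1. *)
by rewrite !ln0 ?invr_le0// mulr0 expR0 invr1.
Qed.

Lemma mxpowN S t : S \in unitmx -> mxpow S (- t) = invmx (mxpow S t).
Proof.
move=> Su; have [Sp|S0] := mxpowP S; last by rewrite !S0 invmx0.
by apply/mxpowE/is_mxpowN.
Qed.

Lemma mxpow_inv S t : S \in unitmx -> mxpow (invmx S) t = invmx (mxpow S t).
Proof.
move=> Su; have [Sp|S0] := mxpowP S.
  by apply/mxpowE/is_mxpow_inv.
(* If only [invmx S] is known to have powers, the inversion rule applied to it, with [invmx] taken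
   on both sides, is the claim. *)
have [Vp|V0] := mxpowP (invmx S); last by rewrite S0 V0 invmx0.
have VSu : invmx S \in unitmx by rewrite unitmx_inv.
by have := mxpowE (is_mxpow_inv VSu (Vp t)); rewrite invmxK => ->;
  rewrite invmxK.
Qed.

(** Prepares for [invmxM], which needs invertible factors; in the other case a zero factor makes
    both sides of the geodesic identity vanish. *)
Lemma mxpow_unitVeq0 S t : S \in unitmx ->
  mxpow S t \in unitmx \/ mxpow S t = 0.
Proof.
move=> Su; have [Sp|S0] := mxpowP S; last by right.
by left; apply: is_mxpow_unit (Sp t).
Qed.

Lemma geodesic_inv A B t : A \in unitmx -> B \in unitmx ->
  invmx (geodesic A B t) = geodesic (invmx A) (invmx B) t.
Proof.
move=> Au Bu; rewrite /geodesic !mxpowN ?unitmx_inv// !mxpow_inv// invmxK.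
have [Pu|->] := mxpow_unitVeq0 2^-1 Au; last by rewrite !invmx0 !mulmx0 invmx0.
set P := mxpow A _ in Pu *.
have VPu : invmx P \in unitmx by rewrite unitmx_inv.
have Su : invmx P *m B *m invmx P \in unitmx by rewrite !unitmx_mul VPu Bu.
(* With P = A^(1/2), the matrices raised to the power t in the two geodesics are inverse to each
   other. *)
have -> : P *m invmx B *m P = invmx (invmx P *m B *m invmx P).
  by rewrite !invmxM ?unitmx_mul ?VPu// invmxK mulmxA.
rewrite mxpow_inv//.
have [Mu|->] := mxpow_unitVeq0 t Su.
  by rewrite !invmxM ?unitmx_mul ?Pu// mulmxA.
by rewrite invmx0 !mulmx0 !mul0mx invmx0.
Qed.

End MatrixPower.

Theorem proposition11 (R : realType) (d : nat) (f : 'M[R]_d -> R)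
    (f_cont : {within posdefmx, continuous f})
    (f_gconvex : g_convex f) :
  let g := fun X : 'M[R]_d => f (invmx X) in
  {within posdefmx, continuous g} /\ g_convex g.
Proof.
move=> g; split.
  apply/subspace_continuousP => A Apos.
  have /subspace_continuousP/(_ _ (posdefmx_inv Apos)) fA := f_cont.
  (* Continuity of [f] is relative to the cone, so inversion must be continuous and also map the
     cone into itself. *)
  apply: cvg_comp fA => U /= VU.
  have := invmx_continuous (posdefmx_unit Apos) VU.
  rewrite /nbhs /= /within /=.
  by apply: (@filterS _ _ (nbhs_filter A)) => X UX Xpos;
    apply: UX (posdefmx_inv Xpos).
move=> A B t Apos Bpos t01; rewrite /g.
rewrite geodesic_inv ?posdefmx_unit//.
by apply: f_gconvex => //; apply: posdefmx_inv.
Qed.
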